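(* Let $(Q,* )$ and $(K,\circ)$ be quandles. Denote by $Q_1,\ldots,Q_k$ the components of $Q$ and by $K_1,\ldots,K_m$ the components of $K$. A map $F\colon Q\times K\to Q\times K$ is an automorphism of the product biquandle $B=(Q\times K,\underline{\ast},\overline{\ast})$ if and only if there exist maps $f_1,\ldots,f_m\colon Q\to Q$ and $g_1,\ldots,g_k\colon K\to K$ such that: (1) the restrictions $f_i|_{Q_j}$ and $g_j|_{K_i}$ are bijections (onto their images) for all $i=1,\ldots,m$ and $j=1,\ldots,k$; (2) the equalities $f_i(x)*f_r(y)=f_i(x*y)$ (for all $x,y\in Q$) and $g_j(a)\circ g_l(b)=g_j(a\circ b)$ (for all $a,b\in K$) hold for every $i,r\in\{1,\ldots,m\}$ and every $j,l\in\{1,\ldots,k\}$; (3) there exists a bijection $\rho\colon\{1,\ldots,k\}\times\{1,\ldots,m\}\to\{1,\ldots,k\}\times\{1,\ldots,m\}$ such that $f_i(Q_j)\times g_j(K_i)=Q_{\rho(j,i)_1}\times K_{\rho(j,i)_2}$ for every $(j,i)\in\{1,\ldots,k\}\times\{1,\ldots,m\}$, where $\rho(j,i)_1$ and $\rho(j,i)_2$ denote the first and second component of the pair $\rho(j,i)$; and $F(x,a)=(f_i(x),g_j(a))$ for every $(x,a)\in Q_j\times K_i$ and all $i,j$.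
   Context: A quandle is a set $Q$ with a binary operation $*$ such that (1) $x*x=x$ for all $x$; (2) for every $y$ the map $S_y(x)=x*y$ is a bijection of $Q$; (3) $(x*y)*z=(x*z)*(y*z)$ for all $x,y,z$. The components of a quandle $Q$ are the equivalence classes of the equivalence relation on $Q$ generated by $x\sim x*y$ for $x,y\in Q$ (each of the two quandles here has finitely many components). The product biquandle of quandles $(Q,* )$ and $(K,\circ)$ is the set $Q\times K$ with the two binary operations $(x,a)\,\underline{\ast}\,(y,b)=(x*y,a)$ and $(x,a)\,\overline{\ast}\,(y,b)=(x,a\circ b)$. An automorphism of it is a bijection of $Q\times K$ preserving both operations. *)

(* Defs.v *)
From HB Require Import structures.
From mathcomp Require Import all_boot all_classical.
From Stdlib Require Import Relation_Operators.

Set Implicit Arguments.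
Unset Strict Implicit.
Unset Printing Implicit Defensive.

Local Open Scope classical_set_scope.

HB.mixin Record isQuandle T := {
  qop : T -> T -> T;
  qopxx : forall x, qop x x = x;
  qop_bij : forall y, bijective (fun x => qop x y);
  qopD : forall x y z, qop (qop x y) z = qop (qop x z) (qop y z)
}.

#[short(type="quandleType")]
HB.structure Definition Quandle := { T of isQuandle T }.

Notation "x *q y" := (qop x y) (at level 40, left associativity).

Section Components.
Variable Q : quandleType.

Definition qstep (x z : Q) : Prop := exists y, z = x *q y.

Definition component (x : Q) : set Q :=
  [set y | clos_refl_sym_trans Q qstep x y].

Definition components : set (set Q) := range component.

End Components.

Arguments components : clear implicits.

Section ProductBiquandle.
Variables Q K : quandleType.

Definition prod_under (u v : (Q * K)%type) : (Q * K)%type := (u.1 *q v.1, u.2).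

Definition prod_over (u v : (Q * K)%type) : (Q * K)%type := (u.1, u.2 *q v.2).

End ProductBiquandle.

Arguments prod_under : clear implicits.
Arguments prod_over : clear implicits.

(* [under] and [over] are the two operations of the biquandle on [T]. *)
Definition biquandle_automorphism (T : Type) (under over : T -> T -> T) (F : T -> T) :=
  [/\ bijective F,
      {morph F : u v / under u v} &
      {morph F : u v / over u v}].

(* Main.v *)
(** On [Q_j x K_i] the first coordinate of an automorphism depends on the second
    argument only through its component [K_i], and symmetrically, because
    [F (x * y, a)] and [F (x, a)] share their second coordinate.  An automorphism
    and its inverse both map cells [Q_j x K_i] into cells, hence permute them.
    Conversely, maps as in (1)-(3) glue to a bijection since [rho] permutes the
    cells and [F] maps each cell bijectively onto its image under [rho]. *)

Require Import Defs.
From HB Require Import structures.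
From mathcomp Require Import all_boot all_classical.
From Stdlib Require Import Relation_Operators.

Set Implicit Arguments.
Unset Strict Implicit.
Unset Printing Implicit Defensive.

Local Open Scope classical_set_scope.

Lemma component_eq (Q : quandleType) (x y : Q) :
  component x = component y <-> component x y.
Proof.
split=> [->|xy]; first exact: rst_refl.
apply/seteqP; split=> z.
  by move=> xz; apply: rst_trans xz; apply: rst_sym.
exact: rst_trans xy.
Qed.

Lemma component_qop (Q : quandleType) (x y : Q) : component x (x *q y).
Proof. by apply: rst_step; exists y. Qed.

Lemma component_invariant (Q : quandleType) (T : Type) (h : Q -> T) :
  (forall x y, h (x *q y) = h x) -> forall x y, component x y -> h x = h y.
Proof.
move=> hop x y; elim=> {x y} [x _ [z ->]|//|x y _ ->//|x y z _ -> _ -> //].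
by rewrite hop.
Qed.

(** It suffices that [h] turns a generating step into a step; the witness [z] may be any element of
    [R], so [h] need not be a homomorphism. *)
Lemma component_morph (Q R : quandleType) (h : Q -> R) :
    (forall x y, exists z, h (x *q y) = h x *q z) ->
  forall x y, component x y -> component (h x) (h y).
Proof.
move=> hop x y; elim=> {x y} [x _ [y ->]|x|x y _|x y z _ xy _].
- by have [z ->] := hop x y; exact: component_qop.
- exact: rst_refl.
- exact: rst_sym.
- exact: rst_trans xy.
Qed.

(** Trades the enumerated sets for a classifying map with chosen representatives, so that lying in a
    given component becomes an equation between indices. *)
Lemma components_index (Q : quandleType) (I : Type) (Qc : I -> set Q) :
    set_bij [set: I] (components Q) Qc ->
  exists (idx : Q -> I) (rep : I -> Q),
    [/\ cancel rep idx, forall i x, Qc i x <-> idx x = i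
      & forall x y, component x y <-> idx x = idx y].
Proof.
move=> [Qc_fun Qc_inj Qc_surj].
have /choice[idx idxE] x : exists i, Qc i = component x.
  by have [|i _ <-] := Qc_surj (component x); [exists x|exists i].
have /choice[rep repE] i : exists x, component x = Qc i.
  by have [//|x _ <-] := Qc_fun i; exists x.
have QcE i x : Qc i x <-> idx x = i.
  rewrite -(repE i) -component_eq -(idxE x) repE.
  by split=> [/Qc_inj->|->] //; rewrite inE.
exists idx, rep; split=> // [i|x y].
  by apply/QcE; rewrite -repE; exact: rst_refl.
rewrite -idxE QcE; split=> ->//.
Qed.

Lemma inverse_biquandle_automorphism (T : Type) (under over : T -> T -> T)
    (F G : T -> T) : cancel F G -> cancel G F ->
  biquandle_automorphism under over F -> biquandle_automorphism under over G.
Proof.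
move=> FK GK [_ Fu Fo]; split; first by exists F.
- by move=> u v; rewrite -{1}(GK u) -{1}(GK v) -Fu FK.
- by move=> u v; rewrite -{1}(GK u) -{1}(GK v) -Fo FK.
Qed.

Section Automorphism.
Variables (Q K : quandleType) (F : Q * K -> Q * K).
Hypothesis autF : biquandle_automorphism (prod_under Q K) (prod_over Q K) F.

(** The operation ignores the second coordinate of its right operand, so [b] is free. This freedom
    gives condition (2) for two different indices [i] and [r]. *)
Lemma automorphism_underE (x y : Q) (a b : K) :
  F (x *q y, a) = ((F (x, a)).1 *q (F (y, b)).1, (F (x, a)).2).
Proof. by have [_ Fu _] := autF; exact: (Fu (x, a) (y, b)). Qed.

Lemma automorphism_overE (x y : Q) (a b : K) :
  F (x, a *q b) = ((F (x, a)).1, (F (x, a)).2 *q (F (y, b)).2).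
Proof. by have [_ _ Fo] := autF; exact: (Fo (x, a) (y, b)). Qed.

Lemma automorphism_fst (x : Q) (a b : K) :
  component a b -> (F (x, a)).1 = (F (x, b)).1.
Proof.
move: a b; apply: (component_invariant (h := fun a => (F (x, a)).1)) => a b.
by rewrite (automorphism_overE x x).
Qed.

Lemma automorphism_snd (a : K) (x y : Q) :
  component x y -> (F (x, a)).2 = (F (y, a)).2.
Proof.
move: x y; apply: (component_invariant (h := fun x => (F (x, a)).2)) => x y.
by rewrite (automorphism_underE x y a a).
Qed.

Lemma automorphism_cell (u v : Q * K) :
    component u.1 v.1 -> component u.2 v.2 ->
  component (F u).1 (F v).1 /\ component (F u).2 (F v).2.
Proof.
case: u v => [x a] [y b] /= xy ab; split.
- rewrite (automorphism_fst x ab).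
  apply: (component_morph (h := fun x => (F (x, b)).1)) xy => {}x z.
  by exists (F (z, b)).1; rewrite (automorphism_underE x z b b).
- rewrite (automorphism_snd a xy).
  apply: (component_morph (h := fun a => (F (y, a)).2)) ab => {}a c.
  by exists (F (y, c)).2; rewrite (automorphism_overE y y a c).
Qed.

End Automorphism.

Theorem theorem4p7 (Q K : quandleType) (k m : nat)
    (Qc : 'I_k -> set Q) (Kc : 'I_m -> set K)
    (hQ : set_bij [set: 'I_k] (components Q) Qc)
    (hK : set_bij [set: 'I_m] (components K) Kc)
    (F : (Q * K)%type -> (Q * K)%type) :
  biquandle_automorphism (prod_under Q K) (prod_over Q K) F <->
  exists (f : 'I_m -> Q -> Q) (g : 'I_k -> K -> K),
    [/\ forall (i : 'I_m) (j : 'I_k),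
          set_bij (Qc j) (f i @` Qc j) (f i) /\
          set_bij (Kc i) (g j @` Kc i) (g j),
        (forall (i r : 'I_m) (x y : Q), f i x *q f r y = f i (x *q y)) /\
        (forall (j l : 'I_k) (a b : K), g j a *q g l b = g j (a *q b)),
        exists rho : ('I_k * 'I_m)%type -> ('I_k * 'I_m)%type,
          bijective rho /\
          forall (j : 'I_k) (i : 'I_m),
            (f i @` Qc j) `*` (g j @` Kc i) =
            Qc (rho (j, i)).1 `*` Kc (rho (j, i)).2
      & forall (i : 'I_m) (j : 'I_k) (x : Q) (a : K),
          Qc j x -> Kc i a -> F (x, a) = (f i x, g j a)].
Proof.
have [p [rp [rpK QcE compQ]]] := components_index hQ.
have [q [rq [rqK KcE compK]]] := components_index hK.
split=> [autF|[f [g [fg_bij [fM gM] [rho [rho_bij rhoE]] FE]]]].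
  have [[G FK GK] _ _] := autF.
  have autG := inverse_biquandle_automorphism FK GK autF.
  pose cell (u : Q * K) := (p u.1, q u.2).
  pose rep (c : 'I_k * 'I_m) := (rp c.1, rq c.2).
  have repK : cancel rep cell by case=> j i; rewrite /cell /= rpK rqK.
  have cellM H : biquandle_automorphism (prod_under Q K) (prod_over Q K) H ->
      forall u v, cell u = cell v -> cell (H u) = cell (H v).
    move=> autH u v [/compQ uv1 /compK uv2].
    have [/compQ e1 /compK e2] := automorphism_cell autH uv1 uv2.
    by rewrite /cell e1 e2.
  (* The maps are slices of [F] at representatives; any other point of the same component gives the
     same slice. *)
  pose f i x := (F (x, rq i)).1; pose g j a := (F (rp j, a)).2.
  have FE x a : F (x, a) = (f (q a) x, g (p x) a).
    rewrite [LHS]surjective_pairing /f /g; congr (_, _).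
      by apply: automorphism_fst => //; apply/compK; rewrite rqK.
    by apply: automorphism_snd => //; apply/compQ; rewrite rpK.
  exists f, g; split.
  - move=> i j; split; split=> //.
    + move=> x y /set_mem/QcE xj /set_mem/QcE yj fxy.
      (* The second coordinates agree too, because [x] and [y] share a component, so injectivity of
         [F] applies. *)
      have : F (x, rq i) = F (y, rq i) by rewrite !FE rqK xj yj fxy.
      by move=> /(can_inj FK)[].
    + move=> a b /set_mem/KcE ai /set_mem/KcE bi gab.
      have : F (rp j, a) = F (rp j, b) by rewrite !FE rpK ai bi gab.
      by move=> /(can_inj FK)[].
  - split=> [i r x y|j l a b].
      by rewrite /f (automorphism_underE autF x y (rq i) (rq r)).
    by rewrite /g (automorphism_overE autF (rp j) (rp l) a b).
  (* [rho] is the action of [F] on cells, read off at representatives; its inverse is the same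
     construction for [G]. *)
  - exists (fun c => cell (F (rep c))); split.
      exists (fun c => cell (G (rep c))) => c.
        rewrite -[RHS]repK -[in RHS](FK (rep c)).
        by apply: cellM => //; rewrite repK.
      rewrite -[RHS]repK -[in RHS](GK (rep c)).
      by apply: cellM => //; rewrite repK.
    move=> j i; apply/seteqP; split=> -[y b] /=.
      move=> [[x /QcE xj <-] [a /KcE ai <-]].
      have : cell (F (x, a)) = cell (F (rep (j, i))).
        by apply: cellM => //; rewrite repK /cell /= xj ai.
      by rewrite FE xj ai => -[e1 e2]; split; [apply/QcE|apply/KcE].
    move=> [/QcE yc /KcE bc].
    (* For the reverse inclusion, pull the point back by [G]: it shares a cell with
       [F (rep (j, i))], so its preimage shares one with [rep (j, i)]. *)
    have : cell (G (y, b)) = (j, i).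
      rewrite -[RHS]repK -[in RHS](FK (rep (j, i))).
      by apply: cellM => //; rewrite /cell /= yc bc.
    case Gyb : (G (y, b)) => [x a] [xj ai].
    have : F (x, a) = (y, b) by rewrite -Gyb GK.
    rewrite FE xj ai => -[<- <-]; split.
      by exists x => //; apply/QcE.
    by exists a => //; apply/KcE.
  - by move=> i j x a /QcE <- /KcE <-.
have FqpE x a : F (x, a) = (f (q a) x, g (p x) a).
  by apply: FE; [apply/QcE|apply/KcE].
(* Acting on a point keeps it in its cell, so the same [f i] and [g j] apply on both sides of the
   morphism identities. *)
have pM x y : p (x *q y) = p x by apply/esym/compQ; exact: component_qop.
have qM a b : q (a *q b) = q a by apply/esym/compK; exact: component_qop.
split; last 2 first.
- by move=> [x a] [y b]; rewrite /prod_under /= !FqpE /= pM (fM (q a) (q b)).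
- by move=> [x a] [y b]; rewrite /prod_over /= !FqpE /= qM (gM (p x) (p y)).
have cellF x a : (p (f (q a) x), q (g (p x) a)) = rho (p x, q a).
  have [/QcE -> /KcE ->] :
      (Qc (rho (p x, q a)).1 `*` Kc (rho (p x, q a)).2) (f (q a) x, g (p x) a).
    by rewrite -rhoE; split; [exists x => //; apply/QcE|exists a => //; apply/KcE].
  by rewrite -surjective_pairing.
rewrite -setTT_bijective; split=> // [[x a] [y b] _ _|[y b] _].
  rewrite !FqpE => -[fxy gab].
  (* Equal images lie in one cell, so injectivity of [rho] puts both points in one cell, where [f]
     and [g] are injective by (1). *)
  have : rho (p x, q a) = rho (p y, q b) by rewrite -!cellF fxy gab.
  move=> /(bij_inj rho_bij)[pxy qab].
  have [[_ f_inj _] [_ g_inj _]] := fg_bij (q b) (p y).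
  rewrite pxy qab in fxy gab.
  by congr (_, _); [apply: f_inj|apply: g_inj] => //; apply/mem_set;
    (apply/QcE || apply/KcE).
(* For surjectivity, the inverse of [rho] names the cell whose image under [F] is the cell of
   [(y, b)]. *)
have [sigma _ sigmaK] := rho_bij.
case jiE : (sigma (p y, q b)) => [j i].
have : (Qc (p y) `*` Kc (q b)) (y, b) by split; [apply/QcE|apply/KcE].
have -> : p y = (rho (j, i)).1 by rewrite -jiE sigmaK.
have -> : q b = (rho (j, i)).2 by rewrite -jiE sigmaK.
rewrite -rhoE => -[/= [x xj <-] [a ai <-]].
by exists (x, a) => //; exact: FE.
Qed.
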